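(* Let $R$ be a noetherian ring and let $n>0$ be an integer. Let $M\in\mathcal{P}_n$ and let $N$ be a countably generated submodule of $M$. Then there exists a $\mathcal{P}_n^{\aleph_0}$-filtration $(M_\alpha:\alpha<\lambda)$ of $M$, with $\lambda>1$, such that $M_1\in\mathcal{P}_n^{\aleph_0}$ and $N\subseteq M_1$.
   Context: Modules are left $R$-modules; noetherian means left and right noetherian. $\mathcal{P}_n$ is the class of left $R$-modules of projective dimension at most $n$. $\mathcal{P}_n^{\aleph_0}$ is the class (a set up to isomorphism) of modules $M$ for which there is an exact sequence $0\to P_n\to\cdots\to P_1\to P_0\to M\to 0$ in which each $P_k$, $0\le k\le n$, is a countably generated projective module. A filtration of a module $M$ indexed by an ordinal $\lambda$ is a family $(M_\alpha:\alpha<\lambda)$ of submodules of $M$ such that $M=\bigcup_{\alpha<\lambda}M_\alpha$, $M_\alpha\subseteq M_{\alpha'}$ whenever $\alpha\le\alpha'$, and $M_\beta=\bigcup_{\alpha<\beta}M_\alpha$ for every (nonzero) limit ordinal $\beta<\lambda$. For a class $\mathcal{S}$, it is an $\mathcal{S}$-filtration if $M_0$ and $M_{\alpha+1}/M_\alpha$, for each $\alpha+1<\lambda$, are isomorphic to elements of $\mathcal{S}$. *)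

(* Defs.v *)
From HB Require Import structures.
From mathcomp Require Import all_boot all_algebra.
From mathcomp Require Import generic_quotient ring_quotient.
From mathcomp Require Import boolp classical_sets cardinality wochoice.

Set Implicit Arguments.
Unset Strict Implicit.
Unset Printing Implicit Defensive.

Import GRing.Theory.
Local Open Scope quotient_scope.
Local Open Scope ring_scope.

(* Rings are associative, unital, and possibly zero (pzRingType).             *)

(* A submodule is a GRing.submodClosed predicate; boolean membership is no    *)
(* restriction in the presence of classical logic.                            *)

Section SubmoduleType.
Variables (R : pzRingType) (V : lmodType R) (S : submodClosed V).

Record submod_of := Submod { submod_val : V; _ : submod_val \in S }.

HB.instance Definition _ := [isSub for submod_val].
HB.instance Definition _ := [Choice of submod_of by <:].
HB.instance Definition _ := [SubChoice_isSubLmodule of submod_of by <:].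

End SubmoduleType.

Section QuotientModule.
Variables (R : pzRingType) (V : lmodType R) (S : submodClosed V).

(* GRing.submodClosed is stated over semirings, without closure under         *)
(* opposites, which the library quotient needs.                               *)
Fact submod_oppr_closed : oppr_closed S.
Proof. by move=> x xS; rewrite -scaleN1r rpredZ. Qed.

Definition submod_zmod : zmodClosed V :=
  HB.pack (GRing.SubmodClosed.sort S) (GRing.isOppClosed.Build V S submod_oppr_closed).

Definition quotmod : Type := Quotient.quot submod_zmod.

HB.instance Definition _ := GRing.Zmodule.on quotmod.
HB.instance Definition _ := ZmodQuotient.on quotmod.

Definition quotmod_scale (a : R) : quotmod -> quotmod :=
  lift_op1 quotmod ( *:%R a).

Lemma pi_quotmod_scale a : {morph \pi_quotmod : x / a *: x >-> quotmod_scale a x}.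
Proof.
move=> x; unlock quotmod_scale; apply/eqP; rewrite piE Quotient.equivE.
rewrite -scalerBr; apply: (@rpredZ _ _ S a).
by have := Quotient.idealrBE submod_zmod x (repr (\pi_quotmod x)); rewrite reprK eqxx.
Qed.

Fact quotmod_scaleA a b x :
  quotmod_scale a (quotmod_scale b x) = quotmod_scale (a * b) x.
Proof. by rewrite -[x]reprK -!pi_quotmod_scale scalerA. Qed.

Fact quotmod_scale1 : left_id 1 quotmod_scale.
Proof. by move=> x; rewrite -[x]reprK -pi_quotmod_scale scale1r. Qed.

Fact quotmod_scaleDr : right_distributive quotmod_scale +%R.
Proof.
move=> a x y; rewrite -[x]reprK -[y]reprK -!(rmorphD, raddfD).
by rewrite -!pi_quotmod_scale -raddfD scalerDr.
Qed.

Fact quotmod_scaleDl x : {morph quotmod_scale^~ x : a b / a + b}.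
Proof. by move=> a b; rewrite -[x]reprK -!pi_quotmod_scale -raddfD scalerDl. Qed.

HB.instance Definition _ := GRing.Zmodule_isLmodule.Build R quotmod
  quotmod_scaleA quotmod_scale1 quotmod_scaleDr quotmod_scaleDl.

Fact pi_quotmod_scalable : scalable (\pi_quotmod : V -> quotmod).
Proof. exact: pi_quotmod_scale. Qed.

HB.instance Definition _ :=
  GRing.isScalable.Build R V quotmod *:%R (\pi_quotmod : V -> quotmod)
    pi_quotmod_scalable.

End QuotientModule.

Section Subquotient.
Variables (R : pzRingType) (V : lmodType R) (A B : submodClosed V).

(* A viewed inside B (as A `&` B in case A is not contained in B). *)
Definition submod_in : {pred submod_of B} := [pred x | val x \in A].

Fact submod_in_closed : submod_closed submod_in.
Proof.
split=> [|a x y]; rewrite !inE ?rpred0 // => xA yA.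
by rewrite linearP rpredD ?rpredZ.
Qed.

HB.instance Definition _ :=
  GRing.isSubmodClosed.Build R (submod_of B) submod_in submod_in_closed.

End Subquotient.
Arguments submod_in {R V} A B.

Section ModuleNotions.
Variable R : pzRingType.
Implicit Types U V W : lmodType R.

Definition isomorphic U V := exists f : {linear U -> V}, bijective f.

Definition countably_generated V :=
  exists X : set V, countable X /\
    forall S : submodClosed V, (forall x, X x -> x \in S) -> forall x, x \in S.

Definition projective (P : lmodType R) :=
  forall U V (g : {linear U -> V}) (f : {linear P -> V}),
    (forall v, exists u, g u = v) ->
    exists h : {linear P -> U}, forall p, g (h p) = f p.

Definition noetherian_module V :=
  forall I : nat -> submodClosed V,
    (forall k, {subset I k <= I k.+1}) ->
    exists k, forall l, (k <= l)%N -> I l =i I k.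

Definition exact_at U V W (f : U -> V) (g : V -> W) :=
  forall v, g v = 0 <-> exists u, f u = v.

(* There is an exact sequence 0 -> P_n -> ... -> P_0 -> V -> 0 with all       *)
(* P_k, 0 <= k <= n, in C; it is continued to the left by zero modules.       *)
Definition has_resolution (C : lmodType R -> Prop) n V :=
  exists (P : nat -> lmodType R)
         (d : forall k, {linear P k.+1 -> P k})
         (e : {linear P 0%N -> V}),
    [/\ forall k, (k <= n)%N -> C (P k),
        forall k, (n < k)%N -> forall x : P k, x = 0,
        forall v, exists x, e x = v,
        exact_at (d 0%N) e
      & forall k, exact_at (d k.+1) (d k)].

Definition proj_dim_le n V := has_resolution projective n V.

Definition proj_dim_le_aleph0 n V :=
  has_resolution (fun P => projective P /\ countably_generated P) n V.

End ModuleNotions.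

(* Right ideals of R are the submodules of R^c as a left module over itself.  *)
Definition noetherian_ring (R : pzRingType) :=
  noetherian_module R^o /\ noetherian_module (R^c)^o.

(* An ordinal lambda is represented by a well-ordered set (L, le); its        *)
(* elements stand for the ordinals alpha < lambda.                            *)
Section WellOrder.
Variables (L : eqType) (le : rel L).

Definition wo_lt a b := le a b && (a != b).

Definition wo_zero a := forall b, le a b.

(* b = a + 1 *)
Definition wo_succ a b := wo_lt a b /\ forall c, wo_lt a c -> le b c.

(* nonzero limit ordinals *)
Definition wo_limit b := ~ wo_zero b /\ ~ exists a, wo_succ a b.

End WellOrder.

Section Filtrations.
Variables (R : pzRingType) (M : lmodType R) (L : eqType) (le : rel L).

Definition filtration (F : L -> submodClosed M) :=
  [/\ forall x, exists a, x \in F a,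
      forall a b, le a b -> {subset F a <= F b}
    & forall b, wo_limit le b ->
        forall x, x \in F b <-> exists2 a, wo_lt le a b & x \in F a].

Definition class_filtration (C : lmodType R -> Prop) (F : L -> submodClosed M) :=
  [/\ filtration F,
      forall z, wo_zero le z -> exists2 V, C V & isomorphic (submod_of (F z)) V
    & forall a b, wo_succ le a b ->
        exists2 V, C V & isomorphic (quotmod (submod_in (F a) (F b))) V].

End Filtrations.

(* Main.v *)
(* The family of submodules A of a projective P over which the filtration is  *)
(* built needs no decomposition of P into countably generated summands: a     *)
(* dual basis (h_p) of P indexed by the elements of P itself, so that         *)
(* x = sum_p h_p(x) p, gives each x a finite support, and one keeps the A     *)
(* containing the supports of their elements. If A <= B are two of them, then *)
(* B/A is projective: lift the elements p of B, choosing 0 for those in A,    *)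
(* and extend with the coefficients h_p.                                      *)
(* Write the resolution of M as Q_{k+1} -> Q_k with Q_0 = M, and call a       *)
(* family A_k <= Q_k good if the A_k contain the supports of their elements   *)
(* (for k > 0) and D(A_{k+1}) is the intersection of A_k with the image of D. *)
(* If A <= B are good then the B_{k+1}/A_{k+1} resolve B_0/A_0. Since R is    *)
(* left noetherian, submodules of modules that are countably generated over A *)
(* are again so, and a back-and-forth argument of length omega enlarges a     *)
(* good family to a good one containing given countable sets by adding only   *)
(* countably many generators. Good families are closed under unions of        *)
(* chains, so transfinite recursion along a well-order of M, adding the       *)
(* generators of N at each step, yields the filtration.                       *)

Require Import Defs.
From HB Require Import structures.
From mathcomp Require Import all_boot all_algebra.
From mathcomp Require Import generic_quotient ring_quotient.
From mathcomp Require Import boolp classical_sets functions cardinality fsbigop.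
From mathcomp Require Import wochoice.

Set Implicit Arguments.
Unset Strict Implicit.
Unset Printing Implicit Defensive.

Import GRing.Theory.
Local Open Scope classical_set_scope.
Local Open Scope quotient_scope.
Local Open Scope ring_scope.

(** View a projective resolution of M as an exact complex with M as its last term. If a subcomplex
    satisfies D(A_{k+1}) = A_k ∩ im D for all k, exactness is inherited, so the quotient of two
    nested ones resolves the quotient of their bottom terms ([good_resolution]). The resolving
    modules are projective when both subcomplexes are closed under supports in dual bases
    ([projective_support]). It remains to enlarge such subcomplexes by countably many generators at
    a time. The delicate point is the supply of lifts: after adding countably many elements to A_k,
    its intersection with im D must still be countably generated over the old A_k. This is where
    left noetherianity enters ([noetherian_cg_over]), and omega rounds of closing up then suffice
    ([good_step]). Each closure condition concerns one element at a time, so it survives unions of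
    chains ([good_tower]). Iterating transfinitely from zero, with a first step that swallows N,
    yields the filtration. *)

(** * Submodules given by predicates, linear maps given by graphs, spans *)

Section Submodules.
Variable R : pzRingType.
Implicit Types V W : lmodType R.

Definition lin_closed V (P : V -> Prop) :=
  P 0 /\ forall a x y, P x -> P y -> P (a *: x + y).

Fact lin_closed_submod V (P : V -> Prop) (hP : lin_closed P) :
  submod_closed ([pred x | `[<P x>]] : {pred V}).
Proof.
have [P0 PD] := hP; split=> [|a x y]; rewrite !unfold_in /=; first by rewrite asboolT.
by move=> /asboolP Px /asboolP Py; rewrite asboolT //; exact: PD.
Qed.

Definition mk_submod V (P : V -> Prop) (hP : lin_closed P) : submodClosed V :=
  HB.pack ([pred x | `[<P x>]] : {pred V})
    (GRing.isSubmodClosed.Build R V _ (lin_closed_submod hP)).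

Lemma mk_submodE V (P : V -> Prop) (hP : lin_closed P) x :
  x \in mk_submod hP <-> P x.
Proof. by split=> /asboolP. Qed.

Lemma submodB V (S : submodClosed V) x y : x \in S -> y \in S -> x - y \in S.
Proof. by move=> xS yS; rewrite rpredD // submod_oppr_closed. Qed.

Lemma mem_lin_closed V (S : submodClosed V) : lin_closed (fun x => x \in S).
Proof. by split=> [|a x y xS yS]; rewrite ?rpred0 // rpredD ?rpredZ. Qed.

Lemma lin_closedI V (P Q : V -> Prop) :
  lin_closed P -> lin_closed Q -> lin_closed (fun x => P x /\ Q x).
Proof.
move=> [P0 PD] [Q0 QD]; split=> // a x y [Px Qx] [Py Qy].
by split; [exact: PD | exact: QD].
Qed.

Lemma linear_graph V W (G : V -> W -> Prop) :
    (forall x, exists y, G x y) ->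
    (forall x y y', G x y -> G x y' -> y = y') ->
    (forall a x x' y y', G x y -> G x' y' -> G (a *: x + x') (a *: y + y')) ->
  exists f : {linear V -> W}, forall x, G x (f x).
Proof.
move=> Gtot Gfun Glin; have [f Gf] := choice Gtot.
have flin : linear f by move=> a x y; apply: Gfun (Glin _ _ _ _ _ (Gf x) (Gf y)).
by exists (HB.pack_for {linear V -> W} f (GRing.isLinear.Build R V W *:%R f flin)).
Qed.

Lemma pi_quotmod_eq0 V (S : submodClosed V) x :
  (\pi_(quotmod S) x == 0) = (x \in S).
Proof.
have -> : 0 = \pi_(quotmod S) 0 by rewrite raddf0.
by rewrite piE Quotient.equivE subr0.
Qed.

Lemma quotmodP V (S : submodClosed V) (q : quotmod S) :
  exists x, q = \pi_(quotmod S) x.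
Proof. by exists (repr q); rewrite reprK. Qed.

Fact span_lin_closed V (X : set V) :
  lin_closed (fun v => forall S : submodClosed V,
    (forall x, X x -> x \in S) -> v \in S).
Proof.
split=> [|a x y xX yX] S XS; first exact: rpred0.
by rewrite rpredD ?rpredZ ?xX ?yX.
Qed.

Definition span V (X : set V) : submodClosed V := mk_submod (span_lin_closed X).

Lemma spanP V (X : set V) v : v \in span X <->
  forall S : submodClosed V, (forall x, X x -> x \in S) -> v \in S.
Proof. exact: mk_submodE. Qed.

Lemma mem_span V (X : set V) x : X x -> x \in span X.
Proof. by move=> Xx; apply/spanP=> S; apply. Qed.

Lemma span_ind V (X : set V) (P : V -> Prop) : lin_closed P ->
  (forall x, X x -> P x) -> forall x, x \in span X -> P x.
Proof.
move=> hP XP x /spanP/(_ (mk_submod hP)) xP; apply/mk_submodE/xP => y Xy.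
by apply/mk_submodE/XP.
Qed.

Lemma span_sub V (X : set V) (S : submodClosed V) :
  (forall x, X x -> x \in S) -> {subset span X <= S}.
Proof. by move=> XS x /spanP; apply. Qed.

End Submodules.

(** * Countable generation over a left noetherian ring *)

Section Noetherian.
Variable R : pzRingType.
Implicit Types V W : lmodType R.

Fact lin_closed_addline V (A : submodClosed V) y :
  lin_closed (fun x => exists r, x - r *: y \in A).
Proof.
split=> [|a x x' [r xA] [r' xA']]; first by exists 0; rewrite scale0r subrr rpred0.
exists (a * r + r'); rewrite scalerDl -scalerA opprD addrACA -scalerBr.
by rewrite rpredD ?rpredZ.
Qed.

(** This is A + Ry. *)
Definition addline V (A : submodClosed V) y := mk_submod (lin_closed_addline A y).

Lemma addlineP V (A : submodClosed V) y x :
  x \in addline A y <-> exists r, x - r *: y \in A.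
Proof. exact: mk_submodE. Qed.

Lemma sub_addline V (A : submodClosed V) y : {subset A <= addline A y}.
Proof. by move=> x xA; apply/addlineP; exists 0; rewrite scale0r subr0. Qed.

Lemma mem_addline V (A : submodClosed V) y : y \in addline A y.
Proof. by apply/addlineP; exists 1; rewrite scale1r subrr rpred0. Qed.

(** Let [f S] be an element of I lying outside S whenever I is not contained in S. The chain J_{k+1}
    = J_k + R f(J_k) becomes stationary, and then f(J_k) in J_k forces I to lie in J_k. Only
    countability matters later, so a sequence of generators is enough. *)
Lemma noetherian_generated V (hV : noetherian_module V) (I : submodClosed V) :
  exists x : nat -> V,
    (forall k, x k \in I) /\ forall y, y \in I -> y \in span (range x).
Proof.
have next (S : submodClosed V) : exists y, y \in I /\
    (y \in S -> forall z, z \in I -> z \in S).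
  have [[y [yI yS]]|noy] := pselect (exists y, y \in I /\ y \notin S).
    by exists y; split=> //; rewrite (negPf yS).
  exists 0; split=> [|_ z zI]; first exact: rpred0.
  by apply: contrapT => /negP zS; apply: noy; exists z.
have [f /all_and2[fI fS]] := choice next.
pose J := fix J k : submodClosed V :=
  if k is k'.+1 then addline (J k') (f (J k')) else span set0.
have Jx k : {subset J k <= span (range (f \o J))}.
  elim: k => [|k IHk] x; first by apply: span_sub.
  move=> /addlineP[r xJ]; rewrite -(subrK (r *: f (J k)) x) rpredD //; first exact: IHk xJ.
  by rewrite rpredZ //; apply: mem_span; exists k.
have [k Jk] := hV J (fun k => @sub_addline _ _ _).
exists (f \o J); split=> [j|y yI]; first exact: fI.
by apply/(Jx k)/fS => //; rewrite -(Jk k.+1) // mem_addline.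
Qed.

Lemma countable_enum V (Y : set V) : countable Y ->
  exists y : nat -> V, forall v, Y v -> exists m, y m = v.
Proof.
move=> /countable_injP[f finj].
have [m|y yP] := @choice nat V (fun m v => forall w, Y w -> f w = m -> v = w).
  have [[v [Yv fv]]|nov] := pselect (exists v, Y v /\ f v = m).
    by exists v => w Yw fw; apply: finj; rewrite ?inE // fv.
  by exists 0 => w Yw fw; case: nov; exists w.
by exists y => v Yv; exists (f v); exact: yP.
Qed.

Definition cg_over V (A B : submodClosed V) :=
  exists Y : set V, [/\ countable Y, forall y, Y y -> y \in B
    & forall x, x \in B -> x \in span ([set` A] `|` Y)].

(** Filter A + span Y by A_m = A + Ry_0 + ... + Ry_{m-1}. For each m the leading coefficients of the
    elements of B in A_{m+1} form a left ideal; lift countably many generators of it to B.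
    Subtracting a combination of these lifts lowers m, so over all m they generate B modulo A. *)
Lemma noetherian_cg_over (hR : noetherian_module R^o) V (A B : submodClosed V)
    (Y : set V) :
  countable Y -> (forall x, x \in B -> x \in span ([set` A] `|` Y)) -> cg_over A B.
Proof.
move=> cY BY; have [y yP] := countable_enum cY.
pose A_ := fix A_ m := if m is m'.+1 then addline (A_ m') (y m') else A.
have A_S m k : {subset A_ m <= A_ (m + k)%N}.
  elim: k => [|k IHk] x xA; first by rewrite addn0.
  by rewrite addnS; apply/sub_addline/IHk.
have A_le m k : (m <= k)%N -> {subset A_ m <= A_ k}.
  by move=> /subnKC <-; exact: A_S.
have BA x : x \in B -> exists m, x \in A_ m.
  move=> /BY; apply: (span_ind (P := fun x => exists m, x \in A_ m)).
    split=> [|a u v [m um] [k vk]]; first by exists 0%N; exact: rpred0.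
    exists (maxn m k); rewrite rpredD ?rpredZ //.
      exact: A_le (leq_maxl m k) _ um.
    exact: A_le (leq_maxr m k) _ vk.
  move=> v [vA|/yP[m <-]]; first by exists 0%N.
  by exists m.+1; exact: mem_addline.
(* The m-th coefficients of the elements of S in A_ m.+1 form a left ideal.   *)
have coef m (S : submodClosed V) :
    lin_closed (fun r : R^o => exists c, c \in S /\ c - (r : R) *: y m \in A_ m).
  split=> [|a r r' [b [bB bA]] [b' [bB' bA']]].
    by exists 0; rewrite scale0r subr0 !rpred0.
  exists (a *: b + b'); split; first by rewrite rpredD ?rpredZ.
  by rewrite scalerDl -scalerA opprD addrACA -scalerBr rpredD ?rpredZ.
have gen m := noetherian_generated hR (mk_submod (coef m B)).
have [r /all_and2[rI rgen]] := choice gen.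
have lift (mj : nat * nat) : exists b, b \in B /\ b - (r mj.1 mj.2 : R) *: y mj.1 \in A_ mj.1.
  by have /mk_submodE := rI mj.1 mj.2.
have [b /all_and2[bB br]] := choice lift.
exists (range b); split=> [|_ [mj _ <-]|x xB]; rewrite ?bB //.
  exact: sub_countable (card_image_le _ _) (countableP _).
have [m] := BA x xB; elim: m x xB => [|m IHm] x xB.
  by move=> xA; apply: mem_span; left.
move=> /addlineP[s xs].
have: (s : R^o) \in mk_submod (coef m B) by apply/mk_submodE; exists x.
move=> /rgen sgen.
(* Generators of the coefficient ideal of B are also coefficients of elements of T, hence so is s:
   some c in T has the same m-th coefficient as x. *)
pose T := mk_submod (lin_closedI (mem_lin_closed B)
  (mem_lin_closed (span ([set` A] `|` range b)))).
have [c [/mk_submodE[cB cb] cs]] : exists c, c \in T /\ c - s *: y m \in A_ m.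
  move: sgen; apply: (span_ind (coef m T)) => _ [j _ <-].
  exists (b (m, j)); split; last exact: (br (m, j)).
  by apply/mk_submodE; split; [exact: bB | apply: mem_span; right; exists (m, j)].
rewrite -(subrK c x) rpredD // IHm //; first exact: submodB.
have -> : x - c = x - s *: y m - (c - s *: y m) by rewrite opprB addrA subrK.
exact: submodB.
Qed.

End Noetherian.

(** * Subquotients B/A and maps between them *)

Section Subquotients.
Variable R : pzRingType.
Implicit Types U V W : lmodType R.

(* Naming these modules as [lmodType]s keeps the canonical structures that    *)
(* unification has to recognize small.                                        *)
Definition submodT V (B : submodClosed V) : lmodType R := submod_of B.

Definition subquot V (A B : submodClosed V) : lmodType R :=
  quotmod (submod_in A B).

Definition incl V (B : submodClosed V) : {linear submodT B -> V} :=
  (val : submod_of B -> V).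

Definition subpi V (A B : submodClosed V) : {linear submodT B -> subquot A B} :=
  \pi_(quotmod (submod_in A B)).

Lemma incl_inj V (B : submodClosed V) : injective (incl B).
Proof. exact: val_inj. Qed.

Lemma mem_incl V (B : submodClosed V) x : incl B x \in B.
Proof. exact: (valP (x : submod_of B)). Qed.

Lemma incl_surj V (B : submodClosed V) v : v \in B -> exists x, incl B x = v.
Proof. by move=> vB; exists (Submod vB). Qed.

Lemma subpi_surj V (A B : submodClosed V) q : exists x, q = subpi A B x.
Proof. exact: quotmodP. Qed.

Lemma subpi_eq0 V (A B : submodClosed V) x : subpi A B x = 0 <-> incl B x \in A.
Proof.
have e := @pi_quotmod_eq0 R (submodT B) (submod_in A B) x.
by split=> [/eqP|xA]; [rewrite e | apply/eqP; rewrite e].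
Qed.

Lemma subpi_eq V (A B : submodClosed V) x y :
  subpi A B x = subpi A B y <-> incl B x - incl B y \in A.
Proof.
rewrite -linearB; split=> [xy|/subpi_eq0/eqP].
  by apply/subpi_eq0; rewrite linearB xy subrr.
by rewrite linearB subr_eq0 => /eqP.
Qed.

Lemma subquot_map V W (g : {linear V -> W}) (A B : submodClosed V)
    (A' B' : submodClosed W) :
    (forall x, x \in A -> g x \in A') -> (forall x, x \in B -> g x \in B') ->
  exists f : {linear subquot A B -> subquot A' B'},
    forall x y, incl B' y = g (incl B x) -> f (subpi A B x) = subpi A' B' y.
Proof.
move=> gA gB.
pose G (q : subquot A B) (q' : subquot A' B') :=
  exists x y, [/\ q = subpi A B x, q' = subpi A' B' y & incl B' y = g (incl B x)].
have Gfun q q1 q2 : G q q1 -> G q q2 -> q1 = q2.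
  move=> [x1 [y1 [-> -> e1]]] [x2 [y2 [/subpi_eq xA -> e2]]].
  by apply/subpi_eq; rewrite e1 e2 -linearB gA.
have [q||f fG] := linear_graph _ Gfun.
- have [x ->] := subpi_surj q.
  have [y yx] := incl_surj (gB _ (mem_incl x)).
  by exists (subpi A' B' y), x, y.
- move=> a q1 q2 q1' q2' [x1 [y1 [-> -> e1]]] [x2 [y2 [-> -> e2]]].
  exists (a *: x1 + x2), (a *: y1 + y2).
  by rewrite !linearP e1 e2.
exists f => x y xy; apply: Gfun (fG _) _.
by exists x, y.
Qed.

Lemma subquot_cg V (A B : submodClosed V) : {subset A <= B} -> cg_over A B ->
  countably_generated (subquot A B).
Proof.
move=> AB [Y [cY YB BY]].
(* The default 0 is taken only outside B, hence never on Y. *)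
pose p v : subquot A B := subpi A B (insubd (0 : submod_of B) v).
exists (p @` Y); split; first exact: sub_countable (card_image_le _ _) cY.
move=> S YS q; have [x ->] := subpi_surj q.
have SP : lin_closed (fun v => exists2 b, incl B b = v & subpi A B b \in S).
  split=> [|a u v [b <- bS] [c <- cS]]; first by exists 0; rewrite ?linear0 ?rpred0.
  by exists (a *: b + c); rewrite linearP // rpredD ?rpredZ.
have [v [vA|Yv]|b /incl_inj <-//] := span_ind SP _ (BY _ (mem_incl x)).
  have [b bv] := incl_surj (AB v vA); exists b => //.
  suff -> : subpi A B b = 0 by exact: rpred0.
  by apply/subpi_eq0; rewrite bv.
exists (insubd (0 : submod_of B) v); first by rewrite /incl /= val_insubd YB.
by apply: YS; exists v.
Qed.

Lemma subpi_bijective V (A B : submodClosed V) : (forall x, x \in A -> x = 0) ->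
  bijective (subpi A B).
Proof.
move=> A0; have [r rK] := choice (@subpi_surj V A B).
exists r => x; last by rewrite -rK.
by apply: (@incl_inj _ B); apply/eqP; rewrite -subr_eq0; apply/eqP/A0/subpi_eq.
Qed.

Lemma has_resolution_iso (C : lmodType R -> Prop) n U V (f : {linear U -> V}) :
  bijective f -> has_resolution C n V -> has_resolution C n U.
Proof.
move=> [f' ff' f'f] [P [d [e [CP P0 esurj ex0 ex]]]].
have [x|x y y' <- /(can_inj ff')//||g eg] :=
    @linear_graph R (P 0%N) U (fun x y => f y = e x).
- by exists (f' (e x)).
- by move=> a x x' y y' fy fy'; rewrite !linearP fy fy'.
exists P, d, g; split=> // [v|v].
  by have [x ex1] := esurj (f v); exists x; apply: (can_inj ff'); rewrite eg.
have [ex01 ex02] := ex0 v; split=> [gv|/ex02].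
  by apply: ex01; rewrite -eg gv linear0.
by rewrite -eg => fgv; apply: (can_inj ff'); rewrite fgv linear0.
Qed.

End Subquotients.

(** * Dual bases and projectivity of subquotients *)

Section DualBases.
Variable R : pzRingType.
Implicit Types P U V W : lmodType R.

Definition finsupp (I : eqType) (f : I -> R) :=
  exists2 s : seq I, uniq s & forall i, i \notin s -> f i = 0.

(** Summing over all of I avoids choosing a support; [comb_seq] evaluates the sum on any list that
    contains one. *)
Definition comb (I : choiceType) W (f : I -> R) (u : I -> W) : W :=
  \sum_(i \in [set: I]) f i *: u i.

Lemma comb_seq (I : choiceType) W (f : I -> R) (u : I -> W) (s : seq I) :
  uniq s -> (forall i, i \notin s -> f i = 0) ->
  comb f u = \sum_(i <- s) f i *: u i.
Proof.
move=> us sf; rewrite /comb (fsbigE s) //; last by move=> i _ /sf->; rewrite scale0r.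
by rewrite [LHS]big_mkcond; apply: eq_bigr => i _; rewrite in_setT.
Qed.

Lemma finsupp2 (I : eqType) (f g : I -> R) : finsupp f -> finsupp g ->
  exists s : seq I, [/\ uniq s, forall i, i \notin s -> f i = 0
    & forall i, i \notin s -> g i = 0].
Proof.
move=> [s _ sf] [t _ tg]; exists (undup (s ++ t)); split=> [|i|i].
- exact: undup_uniq.
- by rewrite mem_undup mem_cat negb_or => /andP[/sf].
- by rewrite mem_undup mem_cat negb_or => /andP[_ /tg].
Qed.

Lemma comb_linear (I : choiceType) W a (f g k : I -> R) (u : I -> W) :
  finsupp f -> finsupp g -> (forall i, k i = a * f i + g i) ->
  comb k u = a *: comb f u + comb g u.
Proof.
move=> fs gs kE; have [s [us sf sg]] := finsupp2 fs gs.
rewrite !(@comb_seq _ _ _ _ s) // => [|i si]; last by rewrite kE sf // sg // mulr0 addr0.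
rewrite scaler_sumr -big_split /=; apply: eq_bigr => i _.
by rewrite kE scalerDl scalerA.
Qed.

Definition dual_basis P (h : P -> P -> R) :=
  [/\ forall a x y p, h (a *: x + y) p = a * h x p + h y p,
      forall x, finsupp (h x) & forall x, comb (h x) id = x].

Fact finsupp_lin_closed (I : eqType) :
  lin_closed (fun f : I -> R^o => finsupp f).
Proof.
split=> [|a f g fs gs]; first by exists [::].
have [s [us sf sg]] := finsupp2 fs gs; exists s => // i si.
by rewrite -[LHS]/(a * f i + g i) sf // sg // mulr0 addr0.
Qed.

(** The finitely supported functions on P form the free module on the set P, which evaluation maps
    onto P. A section of this map provides the coordinates. *)
Lemma projective_dual_basis P : projective P -> exists h, @dual_basis P h.
Proof.
move=> Pproj; pose F := mk_submod (@finsupp_lin_closed P).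
have Ffin x : finsupp (incl F x) by have /mk_submodE := mem_incl x.
have [x|x y y' -> -> //|a x x' y y' -> ->|g gE] :=
    @linear_graph R (submodT F) P (fun x y => y = comb (incl F x : P -> R) id).
- by exists (comb (incl F x : P -> R) id).
- by rewrite -(@comb_linear _ _ a _ _ (incl F (a *: x + x') : P -> R)).
have [v|h hE] := Pproj _ _ g (idfun : {linear P -> P}).
  pose d i : R := if i == v then 1 else 0.
  have dfin : finsupp d.
    by exists [:: v] => // i; rewrite inE /d => /negPf->.
  have [x xd] : exists x, incl F x = (d : P -> R^o) by apply: incl_surj; apply/mk_submodE.
  exists x; rewrite gE xd (@comb_seq _ _ _ _ [:: v]) //.
    by rewrite big_seq1 /d eqxx scale1r.
  by move=> i; rewrite inE /d => /negPf->.
exists (fun x => incl F (h x)); split=> [a x y p|x|x]; last 2 first.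
- exact: Ffin.
- by rewrite -gE hE.
by rewrite !linearP.
Qed.

Definition supp_closed V (supp : V -> set V) (A : submodClosed V) :=
  forall x, x \in A -> forall p, supp x p -> p \in A.

(** Support-closure of A makes the extension [k] vanish on A, since the lifts of elements of A are
    0; support-closure of B means that on B only lifts of elements of B contribute. *)
Lemma dual_basis_subquot P (h : P -> P -> R) (A B : submodClosed P) :
  dual_basis h -> let supp x := [set p | h x p != 0] in
  {subset A <= B} -> supp_closed supp A -> supp_closed supp B ->
  projective (subquot A B).
Proof.
move=> [hlin hfin hid] supp AB sA sB U V g f gsurj.
have lift p : exists u, (p \in A -> u = 0) /\
    forall b, incl B b = p -> g u = f (subpi A B b).
  have [pA|pA] := boolP (p \in A).
    exists 0; split=> // b bp; rewrite linear0.
    suff -> : subpi A B b = 0 by rewrite linear0.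
    by apply/subpi_eq0; rewrite bp.
  have [pB|pB] := boolP (p \in B); last first.
    by exists 0; split=> // b bp; rewrite -bp mem_incl in pB.
  have [b bp] := incl_surj pB; have [u gu] := gsurj (f (subpi A B b)).
  exists u; split=> // c cp.
  by rewrite gu; rewrite (@incl_inj _ _ B c b) // bp.
have [u /all_and2[uA uB]] := choice lift.
pose k x := comb (h x) u.
have klin a x y : k (a *: x + y) = a *: k x + k y.
  by apply: comb_linear => // p; rewrite hlin.
pose G q w := exists b, q = subpi A B b /\ w = k (incl B b).
have [q|q w w' [b [-> ->]] [b' [/subpi_eq bA ->]]||l lG] := @linear_graph R _ _ G.
- by have [b ->] := subpi_surj q; exists (k (incl B b)), b.
- apply/eqP; rewrite -subr_eq0 addrC -scaleN1r -klin scaleN1r addrC.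
  apply/eqP/fsbig1 => p _; have [->|hp] := eqVneq (h (incl B b - incl B b') p) 0.
    by rewrite scale0r.
  by rewrite uA ?scaler0 //; exact: sA bA _ hp.
- move=> a q q' w w' [b [-> ->]] [b' [-> ->]]; exists (a *: b + b').
  by rewrite !linearP klin.
exists l => q; have [b [-> ->]] := lG q.
have [c cP] : exists c : P -> submodT B, forall p, p \in B -> incl B (c p) = p.
  have [p|c cP] := @choice P (submodT B) (fun p b => p \in B -> incl B b = p).
    have [pB|] := boolP (p \in B); last by exists 0.
    by have [b' b'p] := incl_surj pB; exists b'.
  by exists c.
have [s us sh] := hfin (incl B b).
have nzB p : h (incl B b) p != 0 -> p \in B.
  by move=> hp; apply: (sB _ (mem_incl b)).
have bE : b = \sum_(p <- s) h (incl B b) p *: c p.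
  apply: (@incl_inj _ _ B).
  rewrite -[LHS]hid (comb_seq _ us sh) linear_sum; apply: eq_bigr => p _.
  have [->|/nzB pB] := eqVneq (h (incl B b) p) 0; first by rewrite !scale0r linear0.
  by rewrite linearZ cP.
rewrite [in RHS]bE /k (comb_seq _ us sh) !linear_sum; apply: eq_bigr => p _.
rewrite !linearZ /=; have [->|/nzB pB] := eqVneq (h (incl B b) p) 0.
  by rewrite !scale0r.
by rewrite (uB p (c p)) // cP.
Qed.

End DualBases.

(** * Well-orders, and adding a largest element *)

Section WellOrders.
Variables (L : eqType) (le : rel L).
Hypothesis wo : well_order le.

Lemma well_order_refl : reflexive le.
Proof.
move=> x; have [|z [[/eqP -> zmin] _]] := wo (A := pred1 x).
  by exists x; rewrite inE.
by apply: zmin; rewrite inE.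
Qed.

Lemma well_order_total : total le.
Proof.
move=> x y; have [|z [[zxy zmin] _]] := wo (A := pred2 x y).
  by exists x; rewrite inE eqxx.
move: zxy zmin; rewrite inE => /pred2P[->|->] zmin; apply/orP; [left|right];
  by apply: zmin; rewrite inE eqxx ?orbT.
Qed.

Lemma well_order_antisym : antisymmetric le.
Proof.
move=> x y /andP[xy yx]; have [|z [_ zuniq]] := wo (A := pred2 x y).
  by exists x; rewrite inE eqxx.
have zE w : w = x \/ w = y -> z = w.
  move=> wxy; apply: zuniq; split; first by rewrite inE; apply/pred2P.
  by move=> v; rewrite inE => /pred2P[]->; case: wxy => -> //; exact: well_order_refl.
by rewrite -(zE x) ?(zE y) //; [right | left].
Qed.

Lemma wo_lt_total a b : ~~ le a b -> wo_lt le b a.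
Proof.
move=> ab; apply/andP; split; first by have := well_order_total a b; rewrite (negPf ab).
by apply: contraNneq ab => ->; exact: well_order_refl.
Qed.

Lemma wo_lt_wf : well_founded (fun a b => wo_lt le a b).
Proof.
move=> a; apply: contrapT => na.
have [|z [[/asboolP nz zmin] _]] := wo (A := fun x => `[<~ Acc (fun a b => wo_lt le a b) x>]).
  by exists a; apply/asboolP.
apply: nz; constructor => y /andP[yz nyz]; apply: contrapT => ny.
have zy : le z y by apply: zmin; apply/asboolP.
by move/eqP: nyz; apply; apply: well_order_antisym; rewrite yz.
Qed.

Lemma wo_succ_lt a b c : wo_succ le a b -> wo_lt le c b -> c = a \/ wo_lt le c a.
Proof.
move=> [_ bmin] /andP[cb ncb]; have [|nca] := eqVneq c a; [by left | right].
apply/andP; split=> //; apply: contraNT ncb => /wo_lt_total/bmin bc.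
by apply/eqP/well_order_antisym; rewrite cb.
Qed.

Lemma wo_limit_between a b : wo_limit le b -> wo_lt le a b ->
  exists2 c, wo_lt le a c & wo_lt le c b.
Proof.
move=> [_ nsucc] ab; apply: contrapT => noc; apply: nsucc; exists a; split=> // c ac.
by apply: contrapT => /negP/wo_lt_total cb; apply: noc; exists c.
Qed.

Definition with_top (x y : option L) :=
  match y, x with None, _ => true | Some b, Some a => le a b | _, _ => false end.

Lemma well_order_with_top : well_order with_top.
Proof.
apply: antisymmetric_well_order => [[x|] [y|] //= xy|A [a aA]].
  by rewrite (@well_order_antisym x y).
have [[x xA]|noA] := pselect (exists x, Some x \in A).
  have [|z [[zA zmin] _]] := wo (A := fun x => Some x \in A); first by exists x.
  by exists (Some z); split=> // -[w|] // wA; apply: zmin.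
case: a aA => [a|] aA; first by case: noA; exists a.
by exists None; split=> // -[w|] // wA; case: noA; exists w.
Qed.

End WellOrders.

(** * Good subcomplexes and their countable enlargements *)

Section GoodSubcomplexes.
Variable R : pzRingType.
Implicit Types P V : lmodType R.

(** Countability keeps closing up countable; the other clauses make the elements with support in a
    given submodule a submodule. The empty support also qualifies, and serves for M. *)
Definition support_system V (supp : V -> set V) :=
  [/\ forall x, countable (supp x), supp 0 = set0
    & forall a x y, supp (a *: x + y) `<=` supp x `|` supp y].

Lemma countable_setU T (A B : set T) :
  countable A -> countable B -> countable (A `|` B).
Proof.
move=> cA cB; rewrite -bigcup2E; apply: bigcup_countable => // i _.
by rewrite /bigcup2; do 2 case: ifP => _ //; exact: countable0.
Qed.

Lemma projective_support P : projective P -> exists supp : P -> set P,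
  support_system supp /\ forall A B : submodClosed P,
    {subset A <= B} -> supp_closed supp A -> supp_closed supp B ->
    projective (subquot A B).
Proof.
move=> /projective_dual_basis[h hh]; have [hlin hfin _] := hh.
exists (fun x => [set p | h x p != 0]); split; last first.
  by move=> A B; exact: dual_basis_subquot hh.
split=> [x||a x y p /=].
- have [s _ sh] := hfin x; apply/finite_set_countable.
  apply: (@sub_finite_set _ _ [set` s]); last exact: finite_seq.
  by move=> p /=; apply: contra_neqT => /sh.
- apply/seteqP; split=> p //= /eqP[]; rewrite -[X in h X](scaler0 _ (-1)).
  by rewrite -[X in h X]addr0 hlin mulN1r addNr.
by rewrite hlin; have [->|] := eqVneq (h x p) 0; [rewrite mulr0 add0r; right | left].
Qed.

Variables (Q : nat -> lmodType R) (D : forall k, {linear Q k.+1 -> Q k}).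
Variable supp : forall k, Q k -> set (Q k).
Hypothesis supp_sys : forall k, support_system (@supp k).
Hypothesis hR : noetherian_module R^o.

Definition good (A : forall k, submodClosed (Q k)) := forall k,
  [/\ supp_closed (@supp k) (A k),
      forall x, x \in A k.+1 -> D k x \in A k
    & forall x, D k x \in A k -> exists2 y, y \in A k.+1 & D k y = D k x].

Lemma span_subset V (X Y : set V) : X `<=` Y -> {subset span X <= span Y}.
Proof. by move=> XY; apply: span_sub => x /XY; exact: mem_span. Qed.

(** The part of A_k + span Y in the image of D is countably generated over A_k by noetherianity; W
    consists of preimages of such generators. *)
Lemma countable_lift (A : forall k, submodClosed (Q k)) k (Y : set (Q k)) :
  countable Y ->
  exists W : set (Q k.+1), countable W /\
    forall x, D k x \in span ([set` A k] `|` Y) ->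
      exists2 z, z \in span W & D k (x - z) \in A k.
Proof.
move=> cY.
have imD : lin_closed (fun v => exists y, D k y = v).
  split=> [|a u v [y <-] [z <-]]; first by exists 0; rewrite linear0.
  by exists (a *: y + z); rewrite linearP.
pose B := mk_submod (lin_closedI (mem_lin_closed (span ([set` A k] `|` Y))) imD).
have [x /mk_submodE[]//|Z [cZ ZB BZ]] := @noetherian_cg_over _ hR _ (A k) B _ cY.
have [v|l lP] := @choice _ _ (fun v z => v \in B -> D k z = v).
  have [/mk_submodE[_ [y yv]]|vB] := boolP (v \in B); last by exists 0.
  by exists y.
exists (l @` Z); split; first exact: sub_countable (card_image_le _ _) cZ.
move=> x xY; have: D k x \in B by apply/mk_submodE; split=> //; exists x.
move=> /BZ.
pose T v := exists2 z, z \in span (l @` Z) & v - D k z \in A k.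
have TP : lin_closed T.
  split=> [|a u v [y yW yA] [z zW zA]].
    by exists 0; [exact: rpred0 | rewrite linear0 subr0 rpred0].
  exists (a *: y + z); first by rewrite rpredD ?rpredZ.
  by rewrite linearP opprD addrACA -scalerBr rpredD ?rpredZ.
move=> /(span_ind TP)[v [vA|Zv]|z zW zA].
- by exists 0; [exact: rpred0 | rewrite linear0 subr0].
- exists (l v); first by apply: mem_span; exists v.
  by rewrite lP ?ZB // subrr rpred0.
by exists z; rewrite ?linearB.
Qed.

(* One step of the back-and-forth; in the last clause, z lifts x modulo A.    *)
Definition closes_up (A : forall k, submodClosed (Q k))
    (Y Y' : forall k, set (Q k)) := forall k,
  [/\ countable (Y' k), Y k `<=` Y' k,
      forall y, Y k y -> supp y `<=` Y' k,
      forall y, Y k.+1 y -> Y' k (D k y)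
    & forall x, D k x \in span ([set` A k] `|` Y k) ->
        exists2 z, z \in span (Y' k.+1) & D k (x - z) \in A k].

Lemma closes_up_exists A (Y : forall k, set (Q k)) :
  (forall k, countable (Y k)) -> exists Y', closes_up A Y Y'.
Proof.
move=> cY; pose W k := sval (cid (countable_lift A (cY k))).
have WP k : countable (W k) /\
    forall x, D k x \in span ([set` A k] `|` Y k) ->
      exists2 z, z \in span (W k) & D k (x - z) \in A k.
  exact: svalP (cid (countable_lift A (cY k))).
pose W' k : set (Q k) := if k is k'.+1 then W k' else set0.
exists (fun k => Y k `|` \bigcup_(y in Y k) supp y `|` D k @` Y k.+1 `|` W' k).
move=> k; split.
- have cW' : countable (W' k) by case: k => [|k]; [exact: countable0|case: (WP k)].
  apply: countable_setU cW'; apply: countable_setU; last first.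
    exact: sub_countable (card_image_le _ _) (cY k.+1).
  apply: countable_setU => //; apply: bigcup_countable => // y _.
  by have [] := supp_sys k.
- by move=> y Yy; left; left; left.
- by move=> y Yy p yp; left; left; right; exists y.
- by move=> y Yy; left; right; exists y.
move=> x; have [_ /[apply]] := WP k; case=> z zW zA; exists z => //.
by apply: span_subset zW => w Ww; right.
Qed.

(** Close up omega times and add the union to A. Any condition on the result involves one element
    from a finite stage, and the next stage settles it. *)
Lemma good_step A (X : forall k, set (Q k)) :
  good A -> (forall k, countable (X k)) ->
  exists A' : forall k, submodClosed (Q k),
    [/\ good A', forall k, {subset A k <= A' k},
        forall k x, X k x -> x \in A' k & forall k, cg_over (A k) (A' k)].
Proof.
move=> gA cX.
(* On families that are not countable [f] takes a default value; every iterate starting from X is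
   countable. *)
have [Y|f fP] := @choice _ _ (fun Y Y' : forall k, set (Q k) =>
    (forall k, countable (Y k)) -> closes_up A Y Y').
  have [/closes_up_exists-/(_ A)[Y' Y'P]|ncY] := pselect (forall k, countable (Y k)).
    by exists Y'.
  by exists Y.
pose Y m := iter m f X.
have cY m : forall k, countable (Y m k).
  by elim: m => [|m IHm] k; [exact: cX|have [] := fP _ IHm k].
have YP m : closes_up A (Y m) (Y m.+1) := fP _ (cY m).
have Yle k m j : (m <= j)%N -> Y m k `<=` Y j k.
  move=> /subnKC <-; elim: (j - m)%N => [|i IHi] x Yx; first by rewrite addn0.
  by rewrite addnS; have [_ sub _ _ _] := YP (m + i)%N k; apply/sub/IHi.
pose Yw k := \bigcup_m Y m k.
pose A' k := span ([set` A k] `|` Yw k).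
have AA' k : {subset A k <= A' k} by move=> x xA; apply: mem_span; left.
have YA' k m x : Y m k x -> x \in A' k by move=> Yx; apply: mem_span; right; exists m.
exists A'; split=> // [k|k x Xx|k]; last 2 first.
- exact: (YA' k 0%N).
- exists (Yw k); split=> //; last by move=> x [m _]; exact: YA'.
  by apply: bigcup_countable => // m _; exact: cY.
have [sA DA liftA] := gA k; have [_ supp0 suppD] := supp_sys k.
split=> [x xA'|x xA'|x].
- pose T x := forall p, supp x p -> p \in A' k.
  have TP : lin_closed T.
    split=> [p|a u v Tu Tv p /suppD[/Tu|/Tv]//]; first by rewrite supp0.
  move: x xA'; apply: (span_ind TP) => x [xA p xp|[m _ Yx] p xp].
    by apply/AA'/(sA x).
  by apply: (YA' _ m.+1); have [_ _ Ysupp _ _] := YP m k; apply: Ysupp xp.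
- pose T x := D k x \in A' k.
  have TP : lin_closed T.
    split=> [|a u v Tu Tv]; rewrite /T; first by rewrite linear0 rpred0.
    by rewrite linearP rpredD ?rpredZ.
  move: x xA'; apply: (span_ind TP) => x [xA|[m _ Yx]].
    by apply/AA'/DA.
  by apply: (YA' _ m.+1); have [_ _ _ YD _] := YP m k; apply: YD.
pose T v := exists m, v \in span ([set` A k] `|` Y m k).
have TP : lin_closed T.
  split=> [|a u v [m um] [j vj]]; first by exists 0%N; rewrite rpred0.
  exists (maxn m j); rewrite rpredD ?rpredZ //.
    by apply: span_subset um; apply: setUS; apply: Yle; exact: leq_maxl.
  by apply: span_subset vj; apply: setUS; apply: Yle; exact: leq_maxr.
move=> /(span_ind TP)[v [vA|[m _ Yv]]|m xm].
- by exists 0%N; apply: mem_span; left.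
- by exists m; apply: mem_span; right.
(* The new generators give z, which lifts D x only modulo A_k; the remainder D (x - z) lifts to y
   because A is good. *)
have [_ _ _ _ /(_ x xm)[z zY /liftA[y yA Dy]]] := YP m k.
exists (y + z); last by rewrite linearD Dy linearB subrK.
rewrite rpredD //; first exact: AA'.
by apply: span_sub zY => w; exact: YA'.
Qed.

(** * Transfinite iteration of an enlargement step *)

Section Tower.
Variables (L : eqType) (le : rel L) (wo : well_order le).
Variable step : L -> (forall k, submodClosed (Q k)) -> (forall k, submodClosed (Q k)).
Hypothesis sub_step : forall a (A : forall k, submodClosed (Q k)) k,
  {subset A k <= step a A k}.

(** One formula serves all indices: it gives 0 at zero, the step at a successor and the union at a
    limit. *)
Lemma tower_exists : exists G : L -> forall k, submodClosed (Q k), forall a k,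
  G a k = span [set x | exists2 b, wo_lt le b a & x \in step b (G b) k].
Proof.
pose Phi a (g : forall b, wo_lt le b a -> forall k, submodClosed (Q k)) k :=
  span [set x | exists b (ba : wo_lt le b a), x \in step b (g b ba) k].
exists (Fix (wo_lt_wf wo) (fun=> forall k, submodClosed (Q k)) Phi) => a k.
rewrite Fix_eq; last first.
  move=> b g g' gg'; congr Phi.
  by apply: functional_extensionality_dep => c; apply: functional_extensionality_dep.
by congr span; apply/seteqP; split=> x [b]; [move=> [ba xb] | move=> ba xb]; exists b.
Qed.

Variable G : L -> forall k, submodClosed (Q k).
Hypothesis GE : forall a k,
  G a k = span [set x | exists2 b, wo_lt le b a & x \in step b (G b) k].

Lemma step_sub_tower a b k : wo_lt le b a -> {subset step b (G b) k <= G a k}.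
Proof. by move=> ba x xb; rewrite GE; apply: mem_span; exists b. Qed.

Lemma tower_mono a b k : le a b -> {subset G a k <= G b k}.
Proof.
move=> ab x; have [<-//|nab] := eqVneq a b; move=> /(@sub_step a (G a) k).
by apply: step_sub_tower; apply/andP.
Qed.

(** The generating submodules form a chain, so their span is their union; x = 0 is a separate case
    because there may be no index below a. *)
Lemma mem_tower a k x : x \in G a k ->
  x = 0 \/ exists2 b, wo_lt le b a & x \in step b (G b) k.
Proof.
rewrite GE; move: x; apply: span_ind; last by move=> x; right.
split=> [|r x y]; first by left.
case=> [->|[b ba xb]] [->|[c ca yc]].
- by left; rewrite scaler0 addr0.
- by right; exists c; rewrite // scaler0 add0r.
- by right; exists b; rewrite // addr0 rpredZ.
right; have [bc|/(wo_lt_total wo) cb] := boolP (le b c).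
  exists c => //; rewrite rpredD ?rpredZ //.
  have [<-//|nbc] := eqVneq b c.
  by apply/(@sub_step c (G c) k)/(step_sub_tower _ xb); apply/andP.
by exists b; rewrite // rpredD ?rpredZ //; apply/(@sub_step b (G b) k)/(step_sub_tower cb).
Qed.

Lemma good_tower : (forall a, good (G a) -> good (step a (G a))) ->
  forall a, good (G a).
Proof.
move=> good_s; apply: (well_founded_ind (wo_lt_wf wo)) => a IHa k.
have [_ supp0 _] := supp_sys k.
split=> [x|x|x] /mem_tower.
- case=> [-> p|[b ba xb] p xp]; first by rewrite supp0.
  apply: (step_sub_tower ba); have [sA _ _] := good_s b (IHa b ba) k.
  exact: sA xp.
- case=> [->|[b ba xb]]; first by rewrite linear0 rpred0.
  apply: (step_sub_tower ba); have [_ DA _] := good_s b (IHa b ba) k.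
  exact: DA.
case=> [->|[b ba xb]]; first by exists 0; rewrite ?linear0 ?rpred0.
have [_ _ /(_ _ xb)[y yb Dy]] := good_s b (IHa b ba) k.
by exists y => //; exact: step_sub_tower yb.
Qed.

Lemma tower_zero a k : wo_zero le a -> forall x, x \in G a k -> x = 0.
Proof.
move=> a0 x /mem_tower[//|[b /andP[ba /eqP nba] _]].
by case: nba; apply: (well_order_antisym wo); rewrite ba a0.
Qed.

Lemma tower_succ a b k : wo_succ le a b -> G b k =i step a (G a) k.
Proof.
move=> ab x; apply/idP/idP => [/mem_tower[->|[c cb xc]]|].
- exact: rpred0.
- have [<-//|ca] := wo_succ_lt wo ab cb.
  exact/(@sub_step a (G a) k)/(step_sub_tower ca).
by case: ab => ab _; exact: step_sub_tower.
Qed.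

Lemma tower_limit b k x : wo_limit le b ->
  x \in G b k <-> exists2 a, wo_lt le a b & x \in G a k.
Proof.
move=> lim; split=> [/mem_tower[->|[a ab xa]]|[a /andP[ab _]]]; last exact: tower_mono.
  have [nz _] := lim; apply: contrapT => noa; apply: nz => c.
  apply: contrapT => /negP/(wo_lt_total wo) cb.
  by apply: noa; exists c; rewrite ?rpred0.
(* x lies in the step at a, perhaps not in [G a], so an index strictly between a and b is needed. *)
have [c ac cb] := wo_limit_between wo lim ab; exists c => //.
exact: step_sub_tower xa.
Qed.

End Tower.

(** * Resolutions of quotients of good subcomplexes *)

Hypothesis D_surj : forall v, exists x, D 0%N x = v.
Hypothesis D_exact : forall k, exact_at (D k.+1) (D k).
Hypothesis subquot_projective : forall k (A B : submodClosed (Q k.+1)),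
  {subset A <= B} -> supp_closed (@supp k.+1) A -> supp_closed (@supp k.+1) B ->
  projective (subquot A B).
Variable n : nat.
Hypothesis Q_bounded : forall k, (n < k)%N -> forall x : Q k.+1, x = 0.

(** For exactness, let x in B_{k+1} have D x in A_k. Goodness of A gives w in A_{k+1} with D w = D
    x, exactness gives x - w = D u, and goodness of B replaces u by an element of B_{k+2}. *)
Lemma good_resolution A B : good A -> good B ->
  (forall k, {subset A k <= B k}) -> (forall k, cg_over (A k) (B k)) ->
  proj_dim_le_aleph0 n (subquot (A 0%N) (B 0%N)).
Proof.
move=> gA gB AB cgAB; pose S k := subquot (A k) (B k).
have Dq k := @subquot_map R _ _ (D k) (A k.+1) (B k.+1) (A k) (B k)
  (fun x xA => let: And3 _ h _ := gA k in h x xA)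
  (fun x xB => let: And3 _ h _ := gB k in h x xB).
pose d k := sval (cid (Dq k)).
have dE k x y : incl (B k) y = D k (incl (B k.+1) x) ->
    d k (subpi _ _ x) = subpi _ _ y := svalP (cid (Dq k)) x y.
have dex k (x : submodT (B k.+1)) : exists2 y, incl (B k) y = D k (incl (B k.+1) x) &
    d k (subpi (A k.+1) _ x) = subpi (A k) _ y.
  have [_ DB _] := gB k; have [y yx] := incl_surj (DB _ (mem_incl x)).
  by exists y => //; exact: dE.
have dexact k : exact_at (d k.+1) (d k).
  move=> v; have [x ->] := subpi_surj v; have [y yx ->] := dex k x.
  split=> [/subpi_eq0|[t]].
    have [_ _ lA] := gA k; have [_ _ lB] := gB k.+1.
    rewrite yx => /lA[w wA /eqP]; rewrite eq_sym -subr_eq0 -linearB => /eqP.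
    move=> /D_exact[u Du]; have [|u' u'B Du'] := lB u.
      by rewrite Du submodB ?mem_incl ?AB.
    have [t tu] := incl_surj u'B; have [z zt dz] := dex k.+1 t.
    exists (subpi _ _ t); rewrite dz; apply/subpi_eq.
    by rewrite zt tu Du' Du addrAC subrr sub0r; exact: submod_oppr_closed.
  have [u ->] := subpi_surj t; have [z zu ->] := dex k.+1 u => /subpi_eq zx.
  apply/subpi_eq0; rewrite yx.
  have -> : D k (incl _ x) = - D k (incl _ z - incl _ x).
    rewrite linearB opprB; have -> : D k (incl _ z) = 0; last by rewrite subr0.
    by apply/D_exact; exists (incl _ u); rewrite zu.
  by have [_ DA _] := gA k; apply/submod_oppr_closed/DA.
(* The shift by one leaves [S 0] as the module being resolved. *)
exists (fun k => S k.+1), (fun k => d k.+1), (d 0%N); split.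
- move=> k _; have [sA _ _] := gA k.+1; have [sB _ _] := gB k.+1.
  by split; [exact: subquot_projective | exact: subquot_cg].
- move=> k nk x; have [y ->] := subpi_surj x; apply/subpi_eq0.
  by rewrite (Q_bounded nk (incl _ y)) rpred0.
- move=> v; have [y ->] := subpi_surj v.
  have [x xy] := D_surj (incl _ y); have [_ _ lB] := gB 0%N.
  have [|z zB zx] := lB x; first by rewrite xy mem_incl.
  have [w wz] := incl_surj zB; exists (subpi _ _ w).
  by apply: dE; rewrite wz zx.
- exact: dexact.
- by move=> k; exact: dexact.
Qed.

End GoodSubcomplexes.

(** * Assembling the filtration of M *)

Theorem lemma3p2 (R : pzRingType) (hR : noetherian_ring R)
    (n : nat) (hn : (0 < n)%N)
    (M : lmodType R) (hM : proj_dim_le n M)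
    (N : submodClosed M) (hN : countably_generated (submod_of N)) :
  exists (L : eqType) (le : rel L) (F : L -> submodClosed M),
    [/\ well_order le,
        class_filtration le (proj_dim_le_aleph0 n) F
      & exists zero one : L,
          [/\ wo_zero le zero, wo_succ le zero one,
              proj_dim_le_aleph0 n (submod_of (F one))
            & {subset N <= F one}]].
Proof.
have [lR _] := hR; have [P [d [e [Pproj P0 esurj ex0 ex]]]] := hM.
pose Q k : lmodType R := if k is k'.+1 then P k' else M.
pose D k : {linear Q k.+1 -> Q k} :=
  match k return {linear Q k.+1 -> Q k} with 0%N => e | k'.+1 => d k' end.
have Dex k : exact_at (D k.+1) (D k) by case: k.
(* Beyond n the terms vanish, and zero modules are projective. *)
have projP k : projective (P k).
  have [/Pproj//|/P0 Pk0] := leqP k n.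
  move=> U V g f gsurj; have [p|p y y' -> -> //|a x x' y y' -> ->|h hE] :=
    @linear_graph R (P k) U (fun _ u => u = 0).
  - by exists 0.
  - by rewrite scaler0 addr0.
  by exists h => p; rewrite hE (Pk0 p) !linear0.
pose PS k := cid (projective_support (projP k)).
pose supp k : Q k -> set (Q k) :=
  match k return Q k -> set (Q k) with 0%N => fun=> set0 | k'.+1 => sval (PS k') end.
have supp_sys k : support_system (supp k).
  case: k => [|k]; last by case: (svalP (PS k)).
  by split=> // [x|a x y p //]; exact: countable0.
have supp_proj k (A B : submodClosed (Q k.+1)) : {subset A <= B} ->
    supp_closed (supp k.+1) A -> supp_closed (supp k.+1) B ->
    projective (subquot A B).
  by case: (svalP (PS k)) => _; exact.
have [le0 wo0] := well_ordering_principle M.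
(* A filtration is exhausted by its terms, and at a only the elements         *)
(* preceding a have been added: hence a largest index.                        *)
pose le := with_top le0; have wo : well_order le := well_order_with_top wo0.
have [X [cX XN]] := hN.
(* Adding the generators of N at every index puts N inside the first step, whichever element comes
   first; [Some m] also adds m, so that M is exhausted. *)
pose Y (a : option M) k : set (Q k) :=
  match k return set (Q k) with
  | 0%N => (val @` X) `|` [set m | a = Some m]
  | _ => set0
  end.
have cY a k : countable (Y a k).
  case: k => [|k]; last exact: countable0.
  apply: countable_setU; first exact: sub_countable (card_image_le _ _) cX.
  case: a => [m|]; last by rewrite (_ : [set _ | _] = set0) ?countable0 //; apply/seteqP; split.
  apply: (sub_countable (subset_card_le _) (countable1 m)).
  by move=> x /= [->].
(* The step fixes families that are not good, so it is increasing without any condition, as the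
   tower requires. *)
have [aA|s sP] := @choice (option M * (forall k, submodClosed (Q k)))
    (forall k, submodClosed (Q k))
    (fun aA (A' : forall k, submodClosed (Q k)) =>
      (forall k, {subset aA.2 k <= A' k}) /\
      (good D supp aA.2 -> [/\ good D supp A',
        forall k x, Y aA.1 k x -> x \in A' k & forall k, cg_over (aA.2 k) (A' k)])).
  have [gA|nA] := pselect (good D supp aA.2); last by exists aA.2; split=> [k x //|/nA[]].
  by have [A' [gA' sub YA' cA']] := good_step supp_sys lR gA (cY aA.1); exists A'.
pose step a A := s (a, A).
have sub_step a (A : forall k, submodClosed (Q k)) k : {subset A k <= step a A k}.
  by have [sub _] := sP (a, A); exact: sub.
have stepP a (A : forall k, submodClosed (Q k)) : good D supp A -> [/\ good D supp (step a A),
    forall k x, Y a k x -> x \in step a A k & forall k, cg_over (A k) (step a A k)].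
  by have [_ sA] := sP (a, A); exact: sA.
have [G GE] := tower_exists wo step.
have gG : forall a, good D supp (G a).
  by apply: (good_tower supp_sys wo sub_step GE) => a /(stepP a)[].
have [z [[_ zmin] _]] : exists! z, minimum_of le predT z by apply: wo; exists None.
have z0 : wo_zero le z by move=> a; apply: zmin.
have Gz k x : x \in G z k -> x = 0 by exact: (tower_zero wo sub_step GE z0).
have cgS a b : wo_succ le a b -> forall k, cg_over (G a k) (G b k).
  move=> ab k; have [_ _ /(_ k)[W [cW WB BW]]] := stepP a _ (gG a).
  have GbE := tower_succ wo sub_step GE ab.
  by exists W; split=> // x; rewrite GbE; [exact: WB | exact: BW].
have subG a b : le a b -> forall k, {subset G a k <= G b k}.
  by move=> ab k; exact: (tower_mono sub_step GE ab).
have quotC a b : le a b -> (forall k, cg_over (G a k) (G b k)) ->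
    proj_dim_le_aleph0 n (subquot (G a 0%N) (G b 0%N)).
  move=> ab cgab; have Q0 k : (n < k)%N -> forall x : Q k.+1, x = 0 by move/P0.
  exact: (good_resolution esurj Dex supp_proj Q0 (gG a) (gG b) (subG a b ab) cgab).
(* Since [G z] is zero, [G a] is isomorphic to its quotient by [G z]. *)
have subC a : (forall k, cg_over (G z k) (G a k)) ->
    proj_dim_le_aleph0 n (submodT (G a 0%N)).
  move=> cga; apply: has_resolution_iso (quotC z a (z0 a) cga).
  exact: subpi_bijective (Gz 0%N).
have iso_refl (V : lmodType R) : isomorphic V V by exists idfun; exists id.
have [b [[bz bmin] _]] : exists! b, minimum_of le (fun a => wo_lt le z a) b.
  (* Any element other than z lies above it; the witness is chosen to differ from z. *)
  apply: wo; exists (if z is Some _ then None else Some 0).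
  by apply/andP; split; [exact: z0 | case: (z)].
have zb : wo_succ le z b by split=> // c; exact: bmin.
exists (option M), le, (fun a => G a 0%N); split=> //.
  split; first split.
  - move=> x; exists None.
    have [_ Yx _] := stepP (Some x) _ (gG (Some x)).
    have xN : wo_lt le (Some x) None by [].
    by apply: (step_sub_tower GE xN (k := 0%N)); apply: Yx; right.
  - by move=> a c ac; exact: (subG a c ac 0%N).
  - by move=> c cl x; exact: (tower_limit wo sub_step GE (k := 0%N) x cl).
  - move=> a a0; exists (submodT (G a 0%N)); last exact: iso_refl.
    apply: subC => k; exists set0; split=> // x xa.
    by have -> : x = 0; [exact: (tower_zero wo sub_step GE a0 xa) | exact: rpred0].
  move=> a c ac; exists (subquot (G a 0%N) (G c 0%N)); last exact: iso_refl.
  by apply: quotC; [case: ac => /andP[] | exact: cgS].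
exists z, b; split=> //; first by apply: subC; exact: cgS.
move=> x xN; have [_ YA _] := stepP z _ (gG z).
(* Generation by X is about submodules of N, so [G b 0] is pulled back to N. *)
have inF : lin_closed (fun y : submodT N => incl N y \in G b 0%N).
  by split=> [|a u v uG vG]; rewrite ?linear0 ?rpred0 // linearP rpredD ?rpredZ.
suff : (Submod xN : submodT N) \in mk_submod inF by move/mk_submodE.
apply: XN => y Xy; apply/mk_submodE.
by apply: (step_sub_tower GE bz (k := 0%N)); apply: YA; left; exists y.
Qed.
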